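(* For every positive integer $n$, the sequences $P^B_n=(P^B_{n,k})_{k=0}^{n}$ and $Q^B_n=(Q^B_{n,k})_{k=0}^{n}$ are strongly synchronised.
   Context: Let $[n]=\{1,\dots,n\}$. Let $\mathfrak{B}_n$ be the set of permutations $\pi$ of $\{-n,\dots,-1,1,\dots,n\}$ satisfying $\pi(-i)=-\pi(i)$; write $\pi_i=\pi(i)$ for $1\le i\le n$. Define $$\mathrm{inv}_B(\pi)=|\{1\le i<j\le n:\pi_i>\pi_j\}|+|\{1\le i<j\le n:-\pi_i>\pi_j\}|+|\{i\in[n]:\pi_i<0\}|.$$ Let $\mathfrak{B}_n^+\subseteq\mathfrak{B}_n$ be the subset of elements with $\mathrm{inv}_B$ even and $\mathfrak{B}_n^-=\mathfrak{B}_n\setminus\mathfrak{B}_n^+$. The number of (type B) excedances is $$\mathrm{exc}_B(\pi)=|\{i\in[n]:\pi_{|\pi(i)|}>\pi_i\}|+|\{i\in[n]:\pi_i=-i\}|.$$ For $0\le k\le n$, $P^B_{n,k}$ and $Q^B_{n,k}$ denote the numbers of $\pi$ with $\mathrm{exc}_B(\pi)=k$ in $\mathfrak{B}_n^+$ and $\mathfrak{B}_n^-$ respectively. Two non-negative sequences $(a_k)_{k=0}^m$ and $(b_k)_{k=0}^m$ are strongly synchronised if for all $1\le k\le m-1$, $$(\min\{a_k,b_k\})^2\ge \max\{a_{k+1},b_{k+1}\}\cdot\max\{a_{k-1},b_{k-1}\}.$$ *)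

(* Defs.v *)
From mathcomp Require Import all_boot all_order all_fingroup all_algebra.

Set Implicit Arguments.
Unset Strict Implicit.
Unset Printing Implicit Defensive.

Import Order.TTheory GRing.Theory Num.Theory.

(* The set {-n, ..., -1, 1, ..., n}: the pair (i, b) stands for the integer
   i + 1 when b = false and -(i + 1) when b = true; thus i : 'I_n plays the
   role of the element i + 1 of [n] = {1, ..., n}. *)
Notation signed n := ('I_n * bool)%type.

Definition sgn_val n (x : signed n) : int :=
  (if x.2 then - (x.1.+1)%:Z else (x.1.+1)%:Z)%R.

Definition sgn_opp n (x : signed n) : signed n := (x.1, ~~ x.2).

Definition sgn_abs n (x : signed n) : 'I_n := x.1.

Definition sgn_pos n (i : 'I_n) : signed n := (i, false).

Definition signed_perms (n : nat) : {set {perm signed n}} :=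
  [set s : {perm signed n} | [forall x, s (sgn_opp x) == sgn_opp (s x)]].

(* The integer written pi_i. *)
Definition window n (s : {perm signed n}) (i : 'I_n) : int :=
  sgn_val (s (sgn_pos i)).

Definition invB n (s : {perm signed n}) : nat :=
  #|[set p : 'I_n * 'I_n |
      (p.1 < p.2) && (window s p.2 < window s p.1)%R]|
  + #|[set p : 'I_n * 'I_n |
      (p.1 < p.2) && (window s p.2 < - window s p.1)%R]|
  + #|[set i : 'I_n | (window s i < 0)%R]|.

Definition signed_perms_plus (n : nat) : {set {perm signed n}} :=
  [set s in signed_perms n | ~~ odd (invB s)].

Definition signed_perms_minus (n : nat) : {set {perm signed n}} :=
  signed_perms n :\: signed_perms_plus n.

Definition excB n (s : {perm signed n}) : nat :=
  #|[set i : 'I_n | (window s i < window s (sgn_abs (s (sgn_pos i))))%R]|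
  + #|[set i : 'I_n | window s i == (- (i.+1)%:Z)%R]|.

Definition PB (n k : nat) : nat :=
  #|[set s in signed_perms_plus n | excB s == k]|.

Definition QB (n k : nat) : nat :=
  #|[set s in signed_perms_minus n | excB s == k]|.

(* For the sequences (a_k) and (b_k), 0 <= k <= m; values of a and b beyond
   index m are irrelevant. *)
Definition strongly_synchronised (m : nat) (a b : nat -> nat) : Prop :=
  forall k : nat, 1 <= k <= m.-1 ->
    maxn (a k.+1) (b k.+1) * maxn (a k.-1) (b k.-1) <= minn (a k) (b k) ^ 2.

(* Main.v *)
(* Write a signed permutation as a pair (s, e): |pi_i| = s(i), and e(j) is the sign carried by the value j. Reindexing by j = |pi_i|, exc_B becomes a sum over the arcs j -> s(j) of the cycles of s, and the parity of inv_B is sgn(s) times the product of the signs. Inserting n + 1, with either sign, into an arc of weight 1 (resp. 0) leaves exc_B unchanged (resp. raises it by 1), while the two choices of sign have opposite parities; a new fixed point is the only insertion that distinguishes the parities. With M(n, k) and m(n, k) the larger and the smaller of P(n, k) and Q(n, k), and T = M + m, this gives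
     M(n+1, k) = M(n, k) + M(n, k-1) + k T(n, k) + (n+1-k) T(n, k-1)
   and the same recurrence for m. The inequality M(n, k+1) M(n, k-1) <= m(n, k)^2 then propagates by induction on n. *)
Require Import Defs.
From mathcomp Require Import all_boot all_order all_fingroup all_algebra.
From mathcomp Require Import zify ring.

Set Implicit Arguments.
Unset Strict Implicit.
Unset Printing Implicit Defensive.

(** * Parity of inversions and the sign of a permutation *)

Lemma det_Vandermonde_col_perm (R : comNzRingType) n (s : 'S_n) (a : 'rV[R]_n) :
  (\det (Vandermonde n (col_perm s a)) = (-1) ^+ s * \det (Vandermonde n a))%R.
Proof.
have -> : Vandermonde n (col_perm s a) = col_perm s (Vandermonde n a).
  by apply/matrixP => i j; rewrite !mxE.
by rewrite col_permE det_mulmx det_perm odd_permV GRing.mulrC.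
Qed.

Definition inversions n (s : 'S_n) : nat :=
  \sum_(i < n) \sum_(j < n) ((i < j) && (s j < s i)).

(** A factor is negative exactly when its pair is inverted. *)
Lemma sgr_prod_sub n (s : 'S_n) :
  (Num.sg (\prod_(i < n) \prod_(j < n | (i < j)%N) ((s j)%:Z - (s i)%:Z))
     = (-1) ^+ inversions s)%R.
Proof.
rewrite (big_morph _ (@Num.Theory.sgrM _) (@Num.Theory.sgr1 _)).
rewrite /inversions -GRing.prodrXr; apply: eq_bigr => i _.
rewrite (big_morph _ (@Num.Theory.sgrM _) (@Num.Theory.sgr1 _)).
rewrite -GRing.prodrXr big_mkcond; apply: eq_bigr => j _ /=.
case: ltnP => //= lt_ij; case: (ltngtP (s i) (s j)) => /= h.
- by rewrite Num.Theory.gtr0_sg // Num.Theory.subr_gt0.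
- by rewrite Num.Theory.ltr0_sg // Num.Theory.subr_lt0.
- by move/perm_inj: (val_inj h) => eq_ij; rewrite eq_ij ltnn in lt_ij.
Qed.

(* Compare the signs of both Vandermonde determinants, at the points [s 0, s 1, ...] and [0, 1, ...]. *)
Lemma odd_inversions n (s : 'S_n) : odd (inversions s) = s :> bool.
Proof.
pose a : 'rV[int]_n := (\row_i (i : nat)%:Z)%R.
have := det_Vandermonde_col_perm s a; rewrite !det_Vandermonde.
move/(congr1 Num.sg); rewrite Num.Theory.sgrM.
under eq_bigr do under eq_bigr do rewrite !mxE.
under [in RHS]eq_bigr do under eq_bigr do rewrite !mxE.
rewrite sgr_prod_sub.
(* The points 0, 1, ... are read as the values of the identity, which has no inversions. *)
have -> : (\prod_(i < n) \prod_(j < n | (i < j)%N) ((j : nat)%:Z - (i : nat)%:Z)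
  = \prod_(i < n) \prod_(j < n | (i < j)%N)
      (((1%g : 'S_n) j : nat)%:Z - ((1%g : 'S_n) i : nat)%:Z))%R.
  by apply: eq_bigr => i _; apply: eq_bigr => j _; rewrite !perm1.
rewrite sgr_prod_sub [inversions 1]big1 ?GRing.mulr1; last first.
  by move=> i _; apply: big1 => j _; rewrite !perm1; case: ltngtP.
by rewrite -GRing.signr_odd; case: (odd _); case: (odd_perm s).
Qed.

(** * Numerical inequality for the inductive step *)

(* [x, X] and [y, Y] are the (min, max) pairs at two consecutive indices, [a3, b3] and [a0, b0] the outer ones; after the outer products are replaced by their bounds, the two sides differ by [4 (x - y)^2] plus terms with a factor [X - x] or [Y - y]. *)
Lemma sync_step_ineq (p q a3 b3 x X y Y a0 b0 : nat) :
  x <= X -> y <= Y -> a3 <= b3 -> a0 <= b0 ->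
  b3 * Y <= x ^ 2 -> X * b0 <= y ^ 2 -> b3 * b0 <= x * y ->
  (p.+2 * a3 + p.+3 * b3 + q * x + q.+1 * X)
  * (p * y + p.+1 * Y + q.+2 * a0 + q.+3 * b0)
  <= (p.+2 * x + p.+1 * X + q.+2 * y + q.+1 * Y) ^ 2.
Proof.
move=> xX yY ab3 ab0 h1 h2 h3.
pose Z := q * x + q.+1 * X; pose W := p * y + p.+1 * Y.
have A3 : p.+2 * a3 + p.+3 * b3 <= (2 * p + 5) * b3 by nia.
have A0 : q.+2 * a0 + q.+3 * b0 <= (2 * q + 5) * b0 by nia.
have ZX : Z <= (2 * q + 1) * X by rewrite /Z; nia.
have WY : W <= (2 * p + 1) * Y by rewrite /W; nia.
apply: (@leq_trans (((2 * p + 5) * b3 + Z) * (W + (2 * q + 5) * b0))).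
  by apply: leq_mul; rewrite -addnA leq_add.
have T1 : (2 * p + 5) * b3 * W <= (2 * p + 5) * (2 * p + 1) * x ^ 2.
  apply: (leq_trans (leq_mul (leqnn _) WY)).
  rewrite (_ : _ * _ = (2 * p + 5) * (2 * p + 1) * (b3 * Y)); last by ring.
  by rewrite leq_mul.
have T2 : Z * ((2 * q + 5) * b0) <= (2 * q + 5) * (2 * q + 1) * y ^ 2.
  apply: (leq_trans (leq_mul ZX (leqnn _))).
  rewrite (_ : _ * _ = (2 * q + 5) * (2 * q + 1) * (X * b0)); last by ring.
  by rewrite leq_mul.
have T3 : (2 * p + 5) * b3 * ((2 * q + 5) * b0)
    <= (2 * p + 5) * (2 * q + 5) * (x * y).
  rewrite (_ : _ * _ = (2 * p + 5) * (2 * q + 5) * (b3 * b0)); last by ring.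
  by rewrite leq_mul.
rewrite mulnDl (mulnDr (_ * b3)) (mulnDr Z).
apply: (@leq_trans ((2 * p + 5) * (2 * p + 1) * x ^ 2
    + (2 * p + 5) * (2 * q + 5) * (x * y)
    + (Z * W + (2 * q + 5) * (2 * q + 1) * y ^ 2))).
  by apply: leq_add; apply: leq_add.
(* In terms of [d] and [e] the remainder has non-negative coefficients except for [- 8 x y]; this
   term is moved across and absorbed by [4 (x ^ 2 + y ^ 2)]. *)
rewrite /Z /W; have [d ->] : exists d, X = x + d by exists (X - x); rewrite subnKC.
have [e ->] : exists e, Y = y + e by exists (Y - y); rewrite subnKC.
suff E : ((2 * p + 5) * (2 * p + 1) * x ^ 2
    + (2 * p + 5) * (2 * q + 5) * (x * y)
    + ((q * x + q.+1 * (x + d)) * (p * y + p.+1 * (y + e))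
    + (2 * q + 5) * (2 * q + 1) * y ^ 2))
    + (4 * (x ^ 2 + y ^ 2) + (p.+1 ^ 2 * d ^ 2 + q.+1 ^ 2 * e ^ 2
    + p.+1 * q.+1 * (d * e) + 2 * (2 * p + 3) * p.+1 * (x * d)
    + 2 * (2 * q + 3) * q.+1 * (y * e)
    + (2 * p * q + 3 * p + 4 * q + 5) * (x * e)
    + (2 * p * q + 4 * p + 3 * q + 5) * (d * y)))
  = (p.+2 * x + p.+1 * (x + d) + q.+2 * y + q.+1 * (y + e)) ^ 2 + 4 * (2 * (x * y)).
  have C := nat_Cauchy x y.
  rewrite -(leq_add2r (4 * (2 * (x * y)))) -E leq_add2l.
  by apply: leq_trans (leq_addr _ _); rewrite leq_mul2l C.
by ring.
Qed.

(** * Insertion of a new maximum *)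

(** Products apply the left factor first: the arc from [j] to [s j] is replaced by a path through
    [ord_max], while [j = ord_max] creates a fixed point. *)
Definition insert_max n (j : 'I_n.+1) (s : 'S_n) : 'S_n.+1 :=
  (tperm ord_max j * lift_perm ord_max ord_max s)%g.

Lemma insert_max_fix n (s : 'S_n) : insert_max ord_max s = lift_perm ord_max ord_max s.
Proof. by rewrite /insert_max tperm1 mul1g. Qed.

Lemma insert_max_src n (j : 'I_n.+1) (s : 'S_n) : insert_max j s j = ord_max.
Proof. by rewrite permM tpermR lift_perm_id. Qed.

Lemma insert_max_max n (j : 'I_n) (s : 'S_n) :
  insert_max (lift ord_max j) s ord_max = lift ord_max (s j).
Proof. by rewrite permM tpermL lift_perm_lift. Qed.

Lemma insert_max_other n (j i : 'I_n) (s : 'S_n) : i != j ->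
  insert_max (lift ord_max j) s (lift ord_max i) = lift ord_max (s i).
Proof.
move=> ne_ij; rewrite permM tpermD ?lift_perm_lift ?neq_lift //.
by rewrite (inj_eq lift_inj) eq_sym.
Qed.

Lemma odd_insert_max n (j : 'I_n.+1) (s : 'S_n) :
  insert_max j s = (j != ord_max) (+) s :> bool.
Proof. by rewrite odd_mul_tperm odd_lift_perm addbb addFb eq_sym. Qed.

Lemma lift_max_perm_inj n : injective (@lift_perm n ord_max ord_max).
Proof.
move=> s t /permP eq_st; apply/permP => i.
by have := eq_st (lift ord_max i); rewrite !lift_perm_lift => /lift_inj.
Qed.

(** [j] is recovered as the preimage of [ord_max], then [s] by cancelling the transposition; the
    cardinals agree. *)
Lemma insert_max_bij n : bijective (fun p : 'I_n.+1 * 'S_n => insert_max p.1 p.2).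
Proof.
apply: inj_card_bij => [[j s] [k t] /= eq_st|]; last first.
  by rewrite card_prod !card_Sn card_ord factS.
have eq_jk : j = k.
  by apply: (@perm_inj _ (insert_max j s)); rewrite {2}eq_st !insert_max_src.
by move: eq_st; rewrite eq_jk => /mulgI /lift_max_perm_inj ->.
Qed.

Definition ffun_rcons n (e : {ffun 'I_n -> bool}) (b : bool) : {ffun 'I_n.+1 -> bool} :=
  [ffun i => if unlift ord_max i is Some k then e k else b].

Lemma ffun_rcons_lift n (e : {ffun 'I_n -> bool}) b i :
  ffun_rcons e b (lift ord_max i) = e i.
Proof. by rewrite ffunE liftK. Qed.

Lemma ffun_rcons_max n (e : {ffun 'I_n -> bool}) b : ffun_rcons e b ord_max = b.
Proof. by rewrite ffunE unlift_none. Qed.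

Lemma ffun_rcons_bij n :
  bijective (fun p : {ffun 'I_n -> bool} * bool => ffun_rcons p.1 p.2).
Proof.
exists (fun e : {ffun 'I_n.+1 -> bool} => ([ffun i => e (lift ord_max i)], e ord_max)).
  move=> [e b]; rewrite ffun_rcons_max; congr (_, _).
  by apply/ffunP => i; rewrite ffunE ffun_rcons_lift.
move=> e; apply/ffunP => i; case: (unliftP ord_max i) => [k|] -> /=.
  by rewrite ffun_rcons_lift ffunE.
by rewrite ffun_rcons_max.
Qed.

(** * Excedances and sign under insertion *)

(* With [v_i = i + 1] or [- (i + 1)] according to [e i], this decides [v_i < v_j] when [i != j]: the sign at the larger of the two indices decides. *)
Definition ascent n (e : {ffun 'I_n -> bool}) (i j : 'I_n) : bool :=
  if i < j then ~~ e j else e i.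

Definition exc n (s : 'S_n) (e : {ffun 'I_n -> bool}) : nat :=
  \sum_i ascent e i (s i).

Definition sign n (s : 'S_n) (e : {ffun 'I_n -> bool}) : bool :=
  s (+) odd (\sum_i e i).

(* The twist by [exc] makes the value [false] the majority for every [exc]; it is what makes the recurrence for [twisted_count] independent of the parity of [k]. *)
Definition twisted_sign n (s : 'S_n) (e : {ffun 'I_n -> bool}) : bool :=
  sign s e (+) odd (exc s e).

Lemma leq_exc n (s : 'S_n) e : exc s e <= n.
Proof.
rewrite -[leqRHS]card_ord -sum1_card /exc; apply: leq_sum => i _.
exact: leq_b1.
Qed.

Lemma big_ord_lift_max n (F : 'I_n.+1 -> nat) :
  \sum_i F i = \sum_i F (lift ord_max i) + F ord_max.
Proof.
rewrite big_ord_recr /=; congr (_ + _); apply: eq_bigr => i _; congr F.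
by apply: val_inj; exact: esym (lift_max i).
Qed.

Lemma ascent_lift n (e : {ffun 'I_n -> bool}) b i j :
  ascent (ffun_rcons e b) (lift ord_max i) (lift ord_max j) = ascent e i j.
Proof. by rewrite /ascent !lift_max !ffun_rcons_lift. Qed.

Lemma ascent_to_max n (e : {ffun 'I_n -> bool}) b i :
  ascent (ffun_rcons e b) (lift ord_max i) ord_max = ~~ b.
Proof. by rewrite /ascent lift_max ltn_ord ffun_rcons_max. Qed.

Lemma ascent_from_max n (e : {ffun 'I_n -> bool}) b i :
  ascent (ffun_rcons e b) ord_max i = b.
Proof. by rewrite /ascent ltnNge leq_ord ffun_rcons_max. Qed.

Lemma exc_insert_fix n (s : 'S_n) e b :
  exc (insert_max ord_max s) (ffun_rcons e b) = exc s e + b.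
Proof.
rewrite insert_max_fix /exc big_ord_lift_max lift_perm_id ascent_from_max.
by under eq_bigr do rewrite lift_perm_lift ascent_lift.
Qed.

(** The two new arcs have weights [~~ b] and [b]: they contribute 1 for either sign, in place of the
    weight of the old arc. *)
Lemma exc_insert_lift n (s : 'S_n) e b j :
  exc (insert_max (lift ord_max j) s) (ffun_rcons e b)
    = exc s e + ~~ ascent e j (s j).
Proof.
rewrite /exc big_ord_lift_max insert_max_max ascent_from_max.
rewrite (bigD1 j) //= [in RHS](bigD1 j) //= insert_max_src ascent_to_max.
under eq_bigr do rewrite insert_max_other // ascent_lift.
by case: b; case: (ascent e j _) => /=; lia.
Qed.

Lemma sign_insert n (s : 'S_n) e b j :
  sign (insert_max j s) (ffun_rcons e b) = sign s e (+) (j != ord_max) (+) b.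
Proof.
rewrite /sign odd_insert_max big_ord_lift_max ffun_rcons_max.
under eq_bigr do rewrite ffun_rcons_lift.
by rewrite oddD oddb; move: (s : bool) (odd _) (j != _) b => [] [] [] [].
Qed.

(** A new fixed point changes [sign] and the parity of [exc] together, so the twisted sign is kept.
    Each arc yields both twisted signs once; [exc s e] arcs have weight 1 and [n - exc s e] have
    weight 0. *)
Lemma sum_insert n (F : nat -> bool -> nat) :
  \sum_(s : 'S_n.+1) \sum_e F (exc s e) (twisted_sign s e) =
  \sum_(s : 'S_n) \sum_e
    (F (exc s e) (twisted_sign s e) + F (exc s e).+1 (twisted_sign s e)
     + exc s e * (F (exc s e) true + F (exc s e) false)
     + (n - exc s e) * (F (exc s e).+1 true + F (exc s e).+1 false)).
Proof.
rewrite (reindex _ (onW_bij _ (insert_max_bij n))) /=.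
rewrite -(pair_bigA_idem _ (fun j s => \sum_e F (exc (insert_max j s) e)
   (twisted_sign (insert_max j s) e))) ?addn0 //=.
rewrite exchange_big /=; apply: eq_bigr => s _.
under eq_bigr => j _.
  rewrite (reindex _ (onW_bij _ (ffun_rcons_bij n))) /=.
  rewrite -(pair_bigA_idem _ (fun e b => F (exc (insert_max j s) (ffun_rcons e b))
   (twisted_sign (insert_max j s) (ffun_rcons e b)))) ?addn0 //=.
  over.
rewrite exchange_big /=; apply: eq_bigr => e _.
rewrite big_ord_lift_max.
have -> : \sum_b F (exc (insert_max ord_max s) (ffun_rcons e b))
    (twisted_sign (insert_max ord_max s) (ffun_rcons e b))
  = F (exc s e) (twisted_sign s e) + F (exc s e).+1 (twisted_sign s e).
  rewrite big_bool addnC /= /twisted_sign !exc_insert_fix !sign_insert eqxx addn0 addn1.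
  by rewrite !addbF /=; case: (sign s e); case: (odd _).
rewrite addnC -[RHS]addnA; congr (_ + _).
have E j : \sum_b F (exc (insert_max (lift ord_max j) s) (ffun_rcons e b))
    (twisted_sign (insert_max (lift ord_max j) s) (ffun_rcons e b))
  = let k := exc s e + ~~ ascent e j (s j) in F k true + F k false.
  rewrite big_bool /= /twisted_sign !exc_insert_lift !sign_insert.
  by case: (_ (+) (_ != _)); case: (odd _); rewrite //= addnC.
under eq_bigr do rewrite E /=.
have C : \sum_(j < n) ascent e j (s j) = exc s e by [].
have C' : \sum_(j < n) ~~ ascent e j (s j) = n - exc s e.
  apply/eqP; rewrite -(eqn_add2r (exc s e)) subnK ?leq_exc // -C -big_split /=.
  apply/eqP; rewrite -[RHS]card_ord -sum1_card; apply: eq_bigr => j _.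
  by case: ascent.
rewrite -[in RHS]C' -[X in X * (F (exc s e) true + _)]C !big_distrl -big_split /=.
apply: eq_bigr => j _; case: ascent => /=; rewrite ?mul1n ?mul0n ?addn0 //.
by rewrite addn1.
Qed.

(** * Recurrence for the counts *)

Definition twisted_count n k c : nat :=
  #|[set p : 'S_n * {ffun 'I_n -> bool} | (exc p.1 p.2 == k) && (twisted_sign p.1 p.2 == c)]|.

Lemma twisted_countE n k c :
  twisted_count n k c = \sum_(s : 'S_n) \sum_e ((exc s e == k) && (twisted_sign s e == c)).
Proof.
rewrite pair_bigA /= /twisted_count -sum1dep_card big_mkcond.
by apply: eq_bigr => p _; case: (_ && _).
Qed.

Lemma sum_exc_twisted_count n k (f : nat -> nat) :
  \sum_(s : 'S_n) \sum_e f (exc s e) * (exc s e == k)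
    = f k * (twisted_count n k true + twisted_count n k false).
Proof.
rewrite !twisted_countE -big_split big_distrr /=; apply: eq_bigr => s _.
rewrite -big_split big_distrr /=; apply: eq_bigr => e _.
by case: eqP => [->|_]; case: twisted_sign; rewrite /= ?muln0 ?addn0 ?add0n.
Qed.

Lemma twisted_countS0 n c : twisted_count n.+1 0 c = twisted_count n 0 c.
Proof.
rewrite twisted_countE (sum_insert n (fun x d => (x == 0) && (d == c))) twisted_countE.
apply: eq_bigr => s _; apply: eq_bigr => e _ /=.
by rewrite !muln0 !addn0; case: (exc s e) => [|m]; rewrite ?mul0n ?muln0 ?addn0.
Qed.

Lemma twisted_countSS n k c :
  twisted_count n.+1 k.+1 c = twisted_count n k.+1 c + twisted_count n k c
    + k.+1 * (twisted_count n k.+1 true + twisted_count n k.+1 false)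
    + (n - k) * (twisted_count n k true + twisted_count n k false).
Proof.
rewrite -(sum_exc_twisted_count n k.+1 id) -(sum_exc_twisted_count n k (fun x => n - x)).
rewrite twisted_countE (sum_insert n (fun x d => (x == k.+1) && (d == c))) !twisted_countE.
rewrite -!big_split; apply: eq_bigr => s _.
rewrite -!big_split; apply: eq_bigr => e _ /=.
rewrite eqSS; congr (_ + _ * _ + _ * _).
  by case: eqP => _ //; case: c.
by case: eqP => _ //; case: c.
Qed.

Lemma twisted_count0 k c : twisted_count 0 k c = (k == 0) && ~~ c.
Proof.
have u (s : 'S_0) : s = 1%g by apply/permP => -[].
have v (e f : {ffun 'I_0 -> bool}) : e = f by apply/ffunP => -[].
rewrite twisted_countE (big_pred1 1%g) => [|s]; last by rewrite /= (u s) eqxx.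
rewrite (big_pred1 [ffun=> false]) => [|e]; last by apply/esym/eqP/v.
rewrite /twisted_sign /sign /exc !big_ord0 odd_perm1 /= eq_sym.
by case: k c => [|k] [].
Qed.

Lemma twisted_count_gt n k c : n < k -> twisted_count n k c = 0.
Proof.
move=> lt_nk; rewrite twisted_countE big1 // => s _; apply: big1 => e _.
by case: eqP (leq_exc s e) => // ->; rewrite leqNgt lt_nk.
Qed.

(** * Inequalities between the counts *)

Lemma twisted_count_gt0 n k : k <= n -> 0 < twisted_count n k false.
Proof.
elim: n k => [|n IHn] [|k] le_kn; rewrite ?twisted_count0 // ?twisted_countS0 ?IHn //.
by rewrite twisted_countSS !addn_gt0 (IHn k) // orbT.
Qed.

(** The recurrence has the same non-negative coefficients for both signs, so the order at [n = 0]
    propagates. *)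
Lemma leq_twisted_count n k : twisted_count n k true <= twisted_count n k false.
Proof.
elim: n k => [|n IHn] [|k]; rewrite ?twisted_count0 ?twisted_countS0 //.
by rewrite !twisted_countSS !leq_add.
Qed.

Lemma twisted_count_sync n k :
  twisted_count n k.+2 false * twisted_count n k false <= twisted_count n k.+1 true ^ 2.
Proof.
elim: n k => [|n IHn] k; first by rewrite !twisted_count0.
have [lt_kn|le_nk] := ltnP k n; last by rewrite twisted_count_gt.
(* Two consecutive instances of the induction hypothesis are multiplied, and the product of the two
   middle majority counts, positive by [twisted_count_gt0], is cancelled. *)
have IHfar j : twisted_count n j.+3 false * twisted_count n j false
    <= twisted_count n j.+2 true * twisted_count n j.+1 true.
  have [le_jn|lt_nj] := leqP j.+2 n; last by rewrite twisted_count_gt // ltnW.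
  have pos : 0 < twisted_count n j.+2 false * twisted_count n j.+1 false.
    by rewrite muln_gt0 !twisted_count_gt0 // ltnW.
  rewrite -(leq_pmul2r pos).
  apply: (@leq_trans ((twisted_count n j.+2 true * twisted_count n j.+1 true) ^ 2)).
    rewrite expnMn mulnACA; have := leq_mul (IHn j.+1) (IHn j).
    by rewrite mulnACA mulnA -!mulnA mulnCA; lia.
  by rewrite -mulnn leq_mul // leq_mul // leq_twisted_count.
have {lt_kn} [q def_n] : exists q, n = k + q.+1 by exists (n - k).-1; lia.
case: k def_n => [|p] def_n.
  (* No index lies below 0, so the lower outer pair is taken to be zero. *)
  rewrite twisted_countS0 !twisted_countSS.
  have := @sync_step_ineq 0 q (twisted_count n 2 true) (twisted_count n 2 false)
    (twisted_count n 1 true) (twisted_count n 1 false) (twisted_count n 0 true) (twisted_count n 0 false)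
    0 0 (leq_twisted_count _ _) (leq_twisted_count _ _) (leq_twisted_count _ _) isT (IHn 0).
  rewrite !muln0 => /(_ isT isT).
  have -> : n - 1 = q by lia.
  have -> : n - 0 = q.+1 by lia.
  move=> H; apply: leq_trans (leq_trans H _); last first.
    by rewrite leq_eqVlt; apply/orP; left; apply/eqP; congr (_ ^ 2); ring.
  by rewrite leq_eqVlt; apply/orP; left; apply/eqP; congr (_ * _); ring.
rewrite !twisted_countSS.
have := sync_step_ineq p.+1 q (leq_twisted_count n p.+2) (leq_twisted_count n p.+1)
  (leq_twisted_count n p.+3) (leq_twisted_count n p) (IHn p.+1) (IHn p) (IHfar p).
have -> : n - p.+2 = q by lia.
have -> : n - p.+1 = q.+1 by lia.
have -> : n - p = q.+2 by lia.
move=> H; apply: leq_trans (leq_trans H _); last first.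
  by rewrite leq_eqVlt; apply/orP; left; apply/eqP; congr (_ ^ 2); ring.
by rewrite leq_eqVlt; apply/orP; left; apply/eqP; congr (_ * _); ring.
Qed.

(** * Translation to signed permutations *)

Lemma card_set_sum (T : finType) (P : pred T) : #|[set x | P x]| = \sum_x P x.
Proof. by rewrite -sum1dep_card big_mkcond; apply: eq_bigr => x _; case: (P x). Qed.

Fact signed_perm_subproof n (s : 'S_n) (e : {ffun 'I_n -> bool}) :
  injective (fun x : signed n => (s x.1, x.2 (+) e (s x.1))).
Proof. by move=> [i b] [j c] /= [/perm_inj -> /addIb ->]. Qed.

(* [e] records the sign of each value: the signed permutation sends [i] to [s i] or [- s i] according to [e (s i)]. *)
Definition signed_perm n (p : 'S_n * {ffun 'I_n -> bool}) : {perm signed n} :=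
  perm (@signed_perm_subproof n p.1 p.2).

Lemma signed_perm_pos n (s : 'S_n) (e : {ffun 'I_n -> bool}) i :
  signed_perm (s, e) (sgn_pos i) = (s i, e (s i)).
Proof. by rewrite permE. Qed.

Lemma signed_perm_inj n : injective (@signed_perm n).
Proof.
move=> [s e] [t f] eq_st.
have E i : (s i, e (s i)) = (t i, f (t i)).
  by rewrite -!signed_perm_pos eq_st.
have eq_s : s = t by apply/permP => i; case: (E i).
congr (_, _) => //; apply/ffunP => i.
by have [_] := E (s^-1 i)%g; rewrite -eq_s permKV.
Qed.

Lemma signed_perms_image n : signed_perms n = [set @signed_perm n p | p in setT].
Proof.
apply/setP => t; rewrite inE; apply/forallP/imsetP => [t_opp|[[s e] _ ->]]; last first.
  by move=> [i b]; rewrite !permE /sgn_opp /= addNb.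
have t_neg i : t (i, true) = sgn_opp (t (i, false)).
  exact/eqP/(t_opp (i, false)).
(* Equal absolute values force [t] to agree at [i] and [j], or, by oddness, at [i] and [-j]; the
   latter is impossible. *)
have inj_s : injective (fun i => (t (i, false)).1).
  move=> i j eq_ij.
  have [eq_b|ne_b] := eqVneq (t (i, false)).2 (t (j, false)).2.
    have /perm_inj[] // : t (i, false) = t (j, false).
    by rewrite [LHS]surjective_pairing eq_ij eq_b -surjective_pairing.
  have /perm_inj // : t (i, false) = t (j, true).
  rewrite t_neg /sgn_opp -eq_ij [LHS]surjective_pairing; congr (_, _).
  by move: ne_b; case: (t (i, false)).2; case: (t (j, false)).2.
exists (perm inj_s, [ffun j => (t ((perm inj_s)^-1 j, false)).2]%g) => //.
apply/permP => -[i b]; rewrite permE /= ffunE permK permE.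
by case: b; rewrite ?t_neg /sgn_opp -?surjective_pairing.
Qed.

Lemma card_signed_perms n (P : pred {perm signed n}) :
  #|[set t in signed_perms n | P t]| = #|[set p | P (signed_perm p)]|.
Proof.
rewrite -(card_imset _ (@signed_perm_inj n)); apply: eq_card => t.
rewrite inE signed_perms_image; apply/andP/imsetP => [[/imsetP[p _ ->] Pt]|[p]].
  by exists p; rewrite ?inE.
by rewrite inE => Pp ->; split=> //; apply: imset_f.
Qed.

Definition signed_value n (e : {ffun 'I_n -> bool}) (i : 'I_n) : int := sgn_val (i, e i).

Lemma window_signed_perm n (s : 'S_n) (e : {ffun 'I_n -> bool}) i :
  window (signed_perm (s, e)) i = signed_value e (s i).
Proof. by rewrite /window signed_perm_pos. Qed.

Lemma ltr_signed_value n (e : {ffun 'I_n -> bool}) i j :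
  i != j -> (signed_value e i < signed_value e j)%R = ascent e i j.
Proof.
rewrite -val_eqE /ascent /signed_value /sgn_val /= => ne_ij.
by case: ltnP => lt_ij; case: (e i); case: (e j) => /=; lia.
Qed.

(** Position [i] corresponds to the arc from [s i] to [s (s i)]; negative fixed points are the loops
    of weight 1. *)
Lemma excB_signed_perm n (s : 'S_n) (e : {ffun 'I_n -> bool}) :
  excB (signed_perm (s, e)) = exc s e.
Proof.
rewrite /excB !card_set_sum -big_split /=.
rewrite /exc [RHS](reindex_inj (@perm_inj _ s)); apply: eq_bigr => i _ /=.
rewrite signed_perm_pos /sgn_abs !window_signed_perm /=.
have [si|ne_si] := eqVneq (s i) i.
  rewrite !si Order.POrderTheory.ltxx /ascent ltnn /signed_value /sgn_val /=.
  by case: (e i) => /=; lia.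
rewrite ltr_signed_value; last by rewrite (inj_eq perm_inj) eq_sym.
suff /negPf -> : signed_value e (s i) != (- (i.+1)%:Z)%R by rewrite addn0.
by move: ne_si; rewrite /signed_value /sgn_val -val_eqE /=; case: (e _) => /=; lia.
Qed.

(** For [i < j], if [s j < s i] exactly one of the two comparisons holds; otherwise both hold or
    both fail, according to the sign of the value at [j]. The latter pairs give [2 * K]. *)
Lemma odd_invB_signed_perm n (s : 'S_n) (e : {ffun 'I_n -> bool}) :
  odd (invB (signed_perm (s, e))) = sign s e.
Proof.
pose K := \sum_(i < n) \sum_(j < n) [&& i < j, s i < s j & e (s j)].
have -> : invB (signed_perm (s, e)) = inversions s + 2 * K + \sum_i e i.
  rewrite /invB !card_set_sum; congr (_ + _); last first.
    rewrite [RHS](reindex_inj (@perm_inj _ s)); apply: eq_bigr => i _ /=.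
    by rewrite window_signed_perm /signed_value /sgn_val /=; case: (e _) => /=; lia.
  rewrite /inversions /K big_distrr -[LHS]big_split -[RHS]big_split /=.
  rewrite -(pair_bigA _ (fun i j : 'I_n =>
    (i < j) && (window (signed_perm (s, e)) j < window (signed_perm (s, e)) i)%R
    + (i < j) && (window (signed_perm (s, e)) j < - window (signed_perm (s, e)) i)%R)) /=.
  apply: eq_bigr => i _; rewrite big_distrr -big_split; apply: eq_bigr => j _ /=.
  rewrite !window_signed_perm; case: ltnP => //= lt_ij.
  have : s i != s j :> nat by rewrite val_eqE (inj_eq perm_inj) -val_eqE neq_ltn lt_ij.
  by rewrite /signed_value /sgn_val /=; case: (e (s i)); case: (e (s j)) => /=;
    case: ltngtP => //=; lia.
by rewrite oddD (oddD _ (2 * K)) oddM addbF odd_inversions.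
Qed.

(** Even [invB] makes [sign] false, so the twisted sign is the parity of [k]: the majority
    alternates between P and Q. *)
Lemma PBE n k : PB n k = twisted_count n k (odd k).
Proof.
have -> : PB n k = #|[set t in signed_perms n | ~~ odd (invB t) && (excB t == k)]|.
  by apply: eq_card => t; rewrite !inE -andbA.
rewrite card_signed_perms /twisted_count; apply: eq_card => -[s e]; rewrite !inE /=.
rewrite odd_invB_signed_perm excB_signed_perm /twisted_sign andbC.
by case: eqP => // ->; case: sign; case: odd.
Qed.

Lemma QBE n k : QB n k = twisted_count n k (~~ odd k).
Proof.
have -> : QB n k = #|[set t in signed_perms n | odd (invB t) && (excB t == k)]|.
  apply: eq_card => t; rewrite !inE.
  by case: [forall x, _]; rewrite ?andbF /= ?andbT ?negbK.
rewrite card_signed_perms /twisted_count; apply: eq_card => -[s e]; rewrite !inE /=.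
rewrite odd_invB_signed_perm excB_signed_perm /twisted_sign andbC.
by case: eqP => // ->; case: sign; case: odd.
Qed.

Theorem theorem6 (n : nat) (hn : 0 < n) :
  strongly_synchronised n (PB n) (QB n).
Proof.
have maxE k : maxn (PB n k) (QB n k) = twisted_count n k false.
  rewrite PBE QBE; have := leq_twisted_count n k.
  by case: odd => /= [/maxn_idPr|/maxn_idPl].
have minE k : minn (PB n k) (QB n k) = twisted_count n k true.
  rewrite PBE QBE; have := leq_twisted_count n k.
  by case: odd => /= [/minn_idPl|/minn_idPr].
by case=> // k _; rewrite !maxE minE; exact: twisted_count_sync.
Qed.
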